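(* Let $(M,g)$ be a compact connected Riemannian manifold with a Killing vector field $\xi$ of constant length $1$, let $\mathfrak{g}$ be the Lie algebra of Killing vector fields of $(M,g)$, and let $\mathfrak{g}=\mathfrak{g}_0\oplus\mathfrak{g}_{\lambda_1}\oplus\dots\oplus\mathfrak{g}_{\lambda_s}$ be its standard decomposition with respect to $\xi$. Let $A\in\mathfrak{g}_{\lambda_1}\oplus\dots\oplus\mathfrak{g}_{\lambda_s}$. Then: 1. $A$ is orthogonal to $\xi$ at every point of $M$. 2. $\mathcal{L}_\xi A=-A\lrcorner\, d\xi$.
   Context: Vectors and 1-forms are identified using the metric; thus $d\xi$ is the exterior derivative of the 1-form $g(\xi,\cdot)$, $A\lrcorner\, d\xi=d\xi(A,\cdot)$, and statement 2 says that the vector field $\mathcal{L}_\xi A=[\xi,A]$ is dual to the 1-form $-d\xi(A,\cdot)$. Standard decomposition: since the isometry group of $M$ is compact, $\mathcal{L}_\xi=[\xi,\cdot]$ acts on $\mathfrak{g}$ as a skew-symmetric endomorphism for a suitable scalar product on $\mathfrak{g}$, so $\mathfrak{g}=\mathfrak{g}_0\oplus\mathfrak{g}_{\lambda_1}\oplus\dots\oplus\mathfrak{g}_{\lambda_s}$ with distinct real numbers $\lambda_k>0$, where $\mathcal{L}_\xi|_{\mathfrak{g}_0}=0$ (indeed $\mathfrak{g}_0=\ker\mathcal{L}_\xi$) and $\mathcal{L}_\xi\circ\mathcal{L}_\xi|_{\mathfrak{g}_{\lambda_k}}=-\lambda_k^2\,\mathrm{Id}$. *)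

(* Defs.v *)
From HB Require Import structures.
From mathcomp Require Import all_boot all_order all_algebra.
From mathcomp Require Import all_classical all_reals all_analysis.
From mathcomp Require Import ring.

Set Implicit Arguments.
Unset Strict Implicit.
Unset Printing Implicit Defensive.

Import Order.TTheory GRing.Theory Num.Theory.
Import numFieldNormedType.Exports.

Local Open Scope classical_set_scope.
Local Open Scope ring_scope.

Fixpoint is_Ck (R : realType) (n : nat) (W : normedModType R) (k : nat)
    (U : set 'rV[R]_n) (f : 'rV[R]_n -> W) : Prop :=
  (forall x, U x -> {for x, continuous f}) /\
  (if k is k'.+1 then
     forall i : 'I_n,
       (forall x, U x -> derivable f x (delta_mx 0 i)) /\
       is_Ck k' U ('D_(delta_mx 0 i) f)
   else True).

Definition smooth_on (R : realType) (n : nat) (W : normedModType R)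
    (U : set 'rV[R]_n) (f : 'rV[R]_n -> W) : Prop :=
  forall k, is_Ck k U f.

Section IsCkTheory.
Variables (R : realType) (n : nat) (U : set 'rV[R]_n).
Hypothesis oU : open U.
Implicit Types f g : 'rV[R]_n -> R.

Let near_eq f g : {in U, f =1 g} -> forall x, U x -> {near x, f =1 g}.
Proof.
move=> fg x Ux; near=> y; apply: fg; rewrite inE.
by near: y; exact: open_nbhs_nbhs.
Unshelve. all: by end_near. Qed.

Let eq_continuous f g : {in U, f =1 g} ->
  (forall x, U x -> {for x, continuous f}) ->
  forall x, U x -> {for x, continuous g}.
Proof.
move=> fg cf x Ux; rewrite /prop_for /continuous_at -(fg x) ?inE//.
apply: cvg_trans (cf _ Ux).
exact: (@near_eq_cvg _ _ (nbhs x) _ _ _ (near_eq fg Ux)).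
Qed.

Let eq_is_Ck k f g : {in U, f =1 g} -> is_Ck k U f -> is_Ck k U g.
Proof.
elim: k f g => [|k IH] f g fg /= [cf df]; split=> //;
  try exact: eq_continuous fg cf.
move=> i; have [dfi Cfi] := df i; split.
  by move=> x Ux; apply: near_eq_derivable (dfi _ Ux); exact: (near_eq fg).
apply: IH Cfi => x; rewrite inE => Ux.
by apply: near_eq_derive; exact: (near_eq fg).
Qed.

Let is_CkW k f : is_Ck k.+1 U f -> is_Ck k U f.
Proof.
elim: k f => [|k IH] f; first by case.
by move=> [cf df]; split=> // i; have [dfi Cfi] := df i; split=> //; exact: IH.
Qed.

Let is_Ck_cst k (a : R) : is_Ck k U (cst a).
Proof.
elim: k a => [|k IH] a; split=> //.
- by move=> x _; exact: cst_continuous.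
- by move=> x _; exact: cst_continuous.
move=> i; split=> [x _|]; first exact: derivable_cst.
by apply: eq_is_Ck (IH 0) => x _; rewrite derive_cst.
Qed.

Let is_CkD k f g : is_Ck k U f -> is_Ck k U g -> is_Ck k U (f + g).
Proof.
elim: k f g => [|k IH] f g [cf df] [cg dg]; split=> //.
- by move=> x Ux; exact: continuousD (cf _ Ux) (cg _ Ux).
- by move=> x Ux; exact: continuousD (cf _ Ux) (cg _ Ux).
move=> i; have [dfi Cfi] := df i; have [dgi Cgi] := dg i; split.
  by move=> x Ux; exact: derivableD (dfi _ Ux) (dgi _ Ux).
apply: eq_is_Ck (IH _ _ Cfi Cgi) => x; rewrite inE => Ux.
by rewrite deriveD//; [exact: dfi | exact: dgi].
Qed.

Let is_CkM k f g : is_Ck k U f -> is_Ck k U g -> is_Ck k U (f * g).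
Proof.
elim: k f g => [|k IH] f g Hf Hg; have [cf df] := Hf; have [cg dg] := Hg;
  split=> //.
- by move=> x Ux; exact: continuousM (cf _ Ux) (cg _ Ux).
- by move=> x Ux; exact: continuousM (cf _ Ux) (cg _ Ux).
move=> i; have [dfi Cfi] := df i; have [dgi Cgi] := dg i; split.
  by move=> x Ux; exact: derivableM (dfi _ Ux) (dgi _ Ux).
have := is_CkD (IH _ _ (is_CkW Hf) Cgi) (IH _ _ (is_CkW Hg) Cfi).
apply: eq_is_Ck => x; rewrite inE => Ux.
by rewrite deriveM//; [exact: dfi | exact: dgi].
Qed.

Lemma smooth_on_cst (a : R) : smooth_on U (cst a : _ -> R).
Proof. by move=> k; exact: is_Ck_cst. Qed.

Lemma smooth_onD f g : smooth_on U f -> smooth_on U g -> smooth_on U (f + g).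
Proof. by move=> sf sg k; exact: is_CkD. Qed.

Lemma smooth_onM f g : smooth_on U f -> smooth_on U g -> smooth_on U (f * g).
Proof. by move=> sf sg k; exact: is_CkM. Qed.

End IsCkTheory.

(* A homeomorphism between open sets; [chart_fun] is only meaningful on
   [chart_dom], and [chart_inv] on [chart_cod]. *)
Record chart (R : realType) (n : nat) (T : topologicalType) := Chart {
  chart_dom : set T;
  chart_cod : set 'rV[R]_n;
  chart_fun :> T -> 'rV[R]_n;
  chart_inv : 'rV[R]_n -> T;
  chart_dom_open : open chart_dom;
  chart_cod_open : open chart_cod;
  chart_funS : forall p, chart_dom p -> chart_cod (chart_fun p);
  chart_invS : forall x, chart_cod x -> chart_dom (chart_inv x);
  chart_funK : forall p, chart_dom p -> chart_inv (chart_fun p) = p;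
  chart_invK : forall x, chart_cod x -> chart_fun (chart_inv x) = x;
  chart_fun_continuous :
    forall p, chart_dom p -> {for p, continuous chart_fun};
  chart_inv_continuous :
    forall x, chart_cod x -> {for x, continuous chart_inv} }.

Definition transition_smooth (R : realType) (n : nat) (T : topologicalType)
    (c d : chart R n T) : Prop :=
  smooth_on (c @` (chart_dom c `&` chart_dom d)) (d \o chart_inv c).

(* The atlas need not be maximal. *)
Record smooth_manifold (R : realType) (n : nat) := SmoothManifold {
  manifold_sort :> topologicalType;
  atlas : set (chart R n manifold_sort);
  manifold_hausdorff : hausdorff_space manifold_sort;
  manifold_second_countable : @second_countable manifold_sort;
  atlas_cover : forall p : manifold_sort, exists2 c, atlas c & chart_dom c p;
  atlas_compatible :
    forall c d, atlas c -> atlas d -> transition_smooth c d }.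

Section Manifold.
Variables (R : realType) (n : nat) (M : smooth_manifold R n).

Definition is_smooth (f : M -> R) : Prop :=
  forall c, atlas c -> smooth_on (chart_cod c) (f \o chart_inv c).

Definition smooth_pred : {pred M -> R} := fun f => `[< is_smooth f >].

Let smooth_cst (a : R) : cst a \in smooth_pred.
Proof.
by apply/asboolP => c _; apply: smooth_on_cst; exact: chart_cod_open.
Qed.

Let smoothM f g :
  f \in smooth_pred -> g \in smooth_pred -> f * g \in smooth_pred.
Proof.
move=> /asboolP sf /asboolP sg; apply/asboolP => c ac.
exact: (smooth_onM (@chart_cod_open _ _ _ c) (sf _ ac) (sg _ ac)).
Qed.

Let smoothD f g :
  f \in smooth_pred -> g \in smooth_pred -> f + g \in smooth_pred.
Proof.
move=> /asboolP sf /asboolP sg; apply/asboolP => c ac.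
exact: (smooth_onD (@chart_cod_open _ _ _ c) (sf _ ac) (sg _ ac)).
Qed.

Let smoothZ (a : R) f : f \in smooth_pred -> a *: f \in smooth_pred.
Proof. by move=> sf; exact: (smoothM (smooth_cst a) sf). Qed.

Let smoothB f g :
  f \in smooth_pred -> g \in smooth_pred -> f - g \in smooth_pred.
Proof.
by move=> sf sg; rewrite -scaleN1r; apply: smoothD => //; exact: smoothZ.
Qed.

Let smooth_subring : subring_closed smooth_pred.
Proof. by split; [exact: smooth_cst | exact: smoothB | exact: smoothM]. Qed.

Let smooth_submod : submod_closed smooth_pred.
Proof.
split; first exact: smooth_cst.
by move=> a f g sf sg; apply: smoothD => //; exact: smoothZ.
Qed.

HB.instance Definition _ :=
  GRing.isSubringClosed.Build (M -> R) smooth_pred smooth_subring.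
HB.instance Definition _ :=
  GRing.isSubmodClosed.Build R (M -> R) smooth_pred smooth_submod.

Record smooth_fun := SmoothFun {
  smooth_val :> M -> R; _ : smooth_val \in smooth_pred }.

HB.instance Definition _ := [isSub for smooth_val].
HB.instance Definition _ := [Choice of smooth_fun by <:].
HB.instance Definition _ := 
  GRing.SubChoice_isSubComPzRing.Build _ _ smooth_fun smooth_subring.
HB.instance Definition _ := [SubZmodule_isSubLmodule of smooth_fun by <:].

Lemma smoothP (f : smooth_fun) : is_smooth f.
Proof. by case: f => f /= /asboolP. Qed.

Definition mk_smooth (f : M -> R) (sf : is_smooth f) : smooth_fun :=
  SmoothFun (introT (asboolP _) sf).

(* T_p M is the space of derivations of C^oo(M) at [p]. *)
Definition derivation_at (p : M) : {pred smooth_fun -> R} :=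
  fun v => `[< (forall (a : R) (f h : smooth_fun),
                  v (a *: f + h) = a * v f + v h) /\
               (forall f h : smooth_fun, v (f * h) = f p * v h + h p * v f) >].

Let derivation_submod p : submod_closed (derivation_at p).
Proof.
split.
  apply/asboolP; split=> [a f h|f h].
    by rewrite -[LHS]/(0 : R) -[0 f]/(0 : R) -[0 h]/(0 : R) mulr0 addr0.
  by rewrite -[LHS]/(0 : R) -[0 f]/(0 : R) -[0 h]/(0 : R) !mulr0 addr0.
move=> a u v /asboolP[lu du] /asboolP[lv dv]; apply/asboolP; split.
  move=> b f h; rewrite -[LHS]/(a * u (b *: f + h) + v (b *: f + h)) lu lv.
  by rewrite -[RHS]/(b * (a * u f + v f) + (a * u h + v h)); ring.
move=> f h; rewrite -[LHS]/(a * u (f * h) + v (f * h)) du dv.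
by rewrite -[RHS]/(f p * (a * u h + v h) + h p * (a * u f + v f)); ring.
Qed.

HB.instance Definition _ p :=
  GRing.isSubmodClosed.Build R (smooth_fun -> R) (derivation_at p)
    (derivation_submod p).

Record tangent (p : M) := Tangent {
  tangent_val :> smooth_fun -> R; _ : tangent_val \in derivation_at p }.

HB.instance Definition _ p := [isSub for @tangent_val p].
HB.instance Definition _ p := [Choice of tangent p by <:].
HB.instance Definition _ p := [SubChoice_isSubZmodule of tangent p by <:].
HB.instance Definition _ p := [SubZmodule_isSubLmodule of tangent p by <:].

Lemma tangentP p (v : tangent p) a (f h : smooth_fun) :
  v (a *: f + h) = a * v f + v h.
Proof. by case: v => v /= /asboolP[]. Qed.

Lemma tangentD p (v : tangent p) (f h : smooth_fun) : v (f + h) = v f + v h.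
Proof. by rewrite -[f in LHS]scale1r tangentP mul1r. Qed.

Lemma tangentM p (v : tangent p) (f h : smooth_fun) :
  v (f * h) = f p * v h + h p * v f.
Proof. by case: v => v /= /asboolP[]. Qed.

Record vector_field := VectorField {
  vf_at :> forall p : M, tangent p;
  vf_smooth : forall f : smooth_fun, is_smooth (fun p => vf_at p f) }.

Definition vf_app (X : vector_field) (f : smooth_fun) : smooth_fun :=
  mk_smooth (vf_smooth X f).

Lemma vf_eqP (X Y : vector_field) :
  (forall p (f : smooth_fun), X p f = Y p f) -> X = Y.
Proof.
case: X Y => [X sX] [Y sY] /= XY.
suff E : X = Y.
  by case: _ / E in sY *; congr VectorField; exact: Prop_irrelevance.
apply: functional_extensionality_dep => p; apply: val_inj.
by apply/funext => f; exact: XY.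
Qed.

HB.instance Definition _ := gen_eqMixin vector_field.
HB.instance Definition _ := gen_choiceMixin vector_field.

Let vf0_smooth (f : smooth_fun) : is_smooth (fun p => (0 : tangent p) f).
Proof. exact: smoothP (0 : smooth_fun). Qed.

Let vfN_smooth (X : vector_field) (f : smooth_fun) :
  is_smooth (fun p => (- X p) f).
Proof. exact: smoothP (- vf_app X f). Qed.

Let vfD_smooth (X Y : vector_field) (f : smooth_fun) :
  is_smooth (fun p => (X p + Y p) f).
Proof. exact: smoothP (vf_app X f + vf_app Y f). Qed.

Let vfZ_smooth (a : R) (X : vector_field) (f : smooth_fun) :
  is_smooth (fun p => (a *: X p) f).
Proof. exact: smoothP (a *: vf_app X f). Qed.

Definition vf0 := VectorField vf0_smooth.
Definition vf_opp X := VectorField (vfN_smooth X).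
Definition vf_add X Y := VectorField (vfD_smooth X Y).
Definition vf_scale a X := VectorField (vfZ_smooth a X).

Let vf_addA : associative vf_add.
Proof. by move=> X Y Z; apply: vf_eqP => p f; exact: addrA. Qed.
Let vf_addC : commutative vf_add.
Proof. by move=> X Y; apply: vf_eqP => p f; exact: addrC. Qed.
Let vf_add0 : left_id vf0 vf_add.
Proof. by move=> X; apply: vf_eqP => p f; exact: add0r. Qed.
Let vf_addN : left_inverse vf0 vf_opp vf_add.
Proof. by move=> X; apply: vf_eqP => p f; exact: addNr. Qed.

HB.instance Definition _ := GRing.isZmodule.Build vector_field
  vf_addA vf_addC vf_add0 vf_addN.

Let vf_scaleA a b X : vf_scale a (vf_scale b X) = vf_scale (a * b) X.
Proof. by apply: vf_eqP => p f; exact: (mulrA a b (X p f)). Qed.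
Let vf_scale1 : left_id 1 vf_scale.
Proof. by move=> X; apply: vf_eqP => p f; exact: (mul1r (X p f)). Qed.
Let vf_scaleDr : right_distributive vf_scale +%R.
Proof. by move=> a X Y; apply: vf_eqP => p f; exact: (mulrDr a (X p f) (Y p f)). Qed.
Let vf_scaleDl X : {morph vf_scale^~ X : a b / a + b}.
Proof. by move=> a b; apply: vf_eqP => p f; exact: (mulrDl a b (X p f)). Qed.

HB.instance Definition _ := GRing.Zmodule_isLmodule.Build R vector_field
  vf_scaleA vf_scale1 vf_scaleDr vf_scaleDl.

Let bracket_derivation (X Y : vector_field) (p : M) :
  (fun f => X p (vf_app Y f) - Y p (vf_app X f)) \in derivation_at p.
Proof.
have appD (Z : vector_field) a f h :
    vf_app Z (a *: f + h) = a *: vf_app Z f + vf_app Z h.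
  by apply: val_inj; apply/funext => q; exact: tangentP.
have appM (Z : vector_field) f h :
    vf_app Z (f * h) = f * vf_app Z h + h * vf_app Z f.
  by apply: val_inj; apply/funext => q; exact: tangentM.
apply/asboolP; split=> [a f h|f h].
  by rewrite !appD !tangentP; ring.
by rewrite !appM !tangentD !tangentM /=; ring.
Qed.

Definition bracket_at (X Y : vector_field) (p : M) : tangent p :=
  Tangent (bracket_derivation X Y p).

Let bracket_smooth (X Y : vector_field) (f : smooth_fun) :
  is_smooth (fun p => bracket_at X Y p f).
Proof. exact: smoothP (vf_app X (vf_app Y f) - vf_app Y (vf_app X f)). Qed.

(* [X, Y] f = X (Y f) - Y (X f) *)
Definition lie_bracket (X Y : vector_field) : vector_field :=
  VectorField (bracket_smooth X Y).

Definition lie_deriv (X Y : vector_field) : vector_field := lie_bracket X Y.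

Record one_form := OneForm {
  form_at :> forall p : M, tangent p -> R;
  form_linear : forall p, scalar (@form_at p);
  form_smooth : forall X : vector_field, is_smooth (fun p => form_at (X p)) }.

Definition form_app (w : one_form) (X : vector_field) : smooth_fun :=
  mk_smooth (form_smooth w X).

(* The 2-form dw through its values on pairs of vector fields, normalized
   without a factor 1/2:
     dw(X, Y) = X (w(Y)) - Y (w(X)) - w([X, Y]). *)
Definition ext_deriv (w : one_form) (X Y : vector_field) : smooth_fun :=
  vf_app X (form_app w Y) - vf_app Y (form_app w X)
    - form_app w (lie_bracket X Y).

Definition interior_prod (A : vector_field)
    (b : vector_field -> vector_field -> smooth_fun) :
  vector_field -> smooth_fun := b A.

(* Smoothness of 1-forms and metrics is tested on global vector fields, which
   suffices because local fields extend globally after multiplication by a bump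
   function. *)
Record riemannian_metric := RiemannianMetric {
  metric_at :> forall p : M, tangent p -> tangent p -> R;
  metric_sym : forall p (v w : tangent p), metric_at v w = metric_at w v;
  metric_linear : forall p (v : tangent p), scalar (metric_at v);
  metric_posdef : forall p (v : tangent p), v != 0 -> 0 < metric_at v v;
  metric_smooth : forall X Y : vector_field,
    is_smooth (fun p => metric_at (X p) (Y p)) }.

Variable g : riemannian_metric.

Definition metric_app (X Y : vector_field) : smooth_fun :=
  mk_smooth (metric_smooth g X Y).

Definition tangent_norm (p : M) (v : tangent p) : R := Num.sqrt (g p v v).

Definition orthogonal_at (p : M) (v w : tangent p) : Prop := g p v w = 0.

Definition flat (X : vector_field) : one_form :=
  @OneForm (fun p => g p (X p)) (fun p => metric_linear g (X p))
    (fun Y => metric_smooth g X Y).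

(* (L_X g)(Y, Z), from the Leibniz rule for X (g(Y, Z)). *)
Definition lie_deriv_metric (X Y Z : vector_field) : smooth_fun :=
  vf_app X (metric_app Y Z)
    - metric_app (lie_deriv X Y) Z - metric_app Y (lie_deriv X Z).

Definition is_killing (X : vector_field) : Prop :=
  forall Y Z, lie_deriv_metric X Y Z = 0.

Definition killing_fields : set vector_field := [set X | is_killing X].

End Manifold.

Definition is_subspace (R : realType) (E : lmodType R) (W : set E) : Prop :=
  W 0 /\ forall (a : R) u v, W u -> W v -> W (a *: u + v).

Definition sum_subspaces (R : realType) (E : lmodType R) (I : finType)
    (V : I -> set E) : set E :=
  [set x | exists2 x_ : I -> E, forall i, V i (x_ i) & x = \sum_i x_ i].

Definition is_direct_sum (R : realType) (E : lmodType R) (I : finType)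
    (V : I -> set E) (W : set E) : Prop :=
  [/\ forall i, is_subspace (V i),
      W = sum_subspaces V &
      forall x_ : I -> E, (forall i, V i (x_ i)) -> \sum_i x_ i = 0 ->
        forall i, x_ i = 0].

(* The summands are [V0] and the [V k], hence the index type [option 'I_s]. *)
Definition standard_decomposition (R : realType) (n : nat)
    (M : smooth_manifold R n) (g : riemannian_metric M) (xi : vector_field M)
    (s : nat) (lambda : 'I_s -> R) (V0 : set (vector_field M))
    (V : 'I_s -> set (vector_field M)) : Prop :=
  [/\ is_direct_sum (oapp V V0) (killing_fields g),
      injective lambda,
      forall k, 0 < lambda k,
      forall X, V0 X -> lie_deriv xi X = 0 &
      forall k X, V k X ->
        lie_deriv xi (lie_deriv xi X) = - (lambda k ^+ 2) *: X].

(* Main.v *)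
(* Since g(xi,xi) = 1, every Killing field X satisfies
   0 = X g(xi,xi) = 2 g([X,xi],xi), i.e. L_xi X is orthogonal to xi.
   Differentiating g(L_xi X, xi) = 0 along the Killing field xi shows that
   L_xi (L_xi X) is orthogonal to xi as well; on g_lambda this field is
   -lambda^2 X, so X itself is orthogonal to xi.  The second claim is then the
   Killing equation of A, because the term Y g(xi,A) of dxi(A,Y) vanishes. *)

Require Import Defs.
From HB Require Import structures.
From mathcomp Require Import all_boot all_order all_algebra.
From mathcomp Require Import all_classical all_reals all_analysis.

Set Implicit Arguments.
Unset Strict Implicit.
Unset Printing Implicit Defensive.

Import Order.TTheory GRing.Theory Num.Theory.
Import numFieldNormedType.Exports.

Local Open Scope classical_set_scope.
Local Open Scope ring_scope.

Section KillingFields.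
Variables (R : realType) (n : nat) (M : smooth_manifold R n).
Variable g : riemannian_metric M.
Implicit Types X Y Z : vector_field M.

Lemma tangent0 (p : M) (v : tangent p) : v 0 = 0.
Proof. by apply: (addrI (v 0)); rewrite -tangentD !addr0. Qed.

(** The Leibniz rule on [1 * 1] gives [v 1 = v 1 + v 1]. This is what makes the derivative of the
    constant g(xi,xi) vanish. *)
Lemma tangent1 (p : M) (v : tangent p) : v 1 = 0.
Proof.
have E : v (1 * 1) = 1 * v 1 + 1 * v 1 by exact: tangentM.
by apply: (addrI (v 1)); rewrite addr0 -[v 1 in LHS]mul1r -E mulr1.
Qed.

Lemma metricDr (p : M) (u v w : tangent p) : g p u (v + w) = g p u v + g p u w.
Proof. by have := metric_linear g u 1 v w; rewrite scale1r mul1r. Qed.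

Lemma metric0r (p : M) (u : tangent p) : g p u 0 = 0.
Proof. by apply: (addrI (g p u 0)); rewrite -metricDr !addr0. Qed.

Lemma metricZr (p : M) (u v : tangent p) a : g p u (a *: v) = a * g p u v.
Proof. by have := metric_linear g u a v 0; rewrite metric0r !addr0. Qed.

Lemma metricNr (p : M) (u v : tangent p) : g p u (- v) = - g p u v.
Proof. by rewrite -scaleN1r metricZr mulN1r. Qed.

Lemma metric_sumr (I : finType) (X : I -> vector_field M) (p : M)
    (v : tangent p) :
  g p v ((\sum_i X i) p) = \sum_i g p v (X i p).
Proof.
apply: (big_morph (fun Y : vector_field M => g p v (Y p))) => [Y Z|].
  exact: metricDr.
exact: metric0r.
Qed.

Lemma lie_bracketC X Y p : lie_bracket X Y p = - lie_bracket Y X p.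
Proof.
apply: val_inj; apply/funext => f.
exact: esym (opprB (Y p (vf_app X f)) (X p (vf_app Y f))).
Qed.

Lemma lie_bracketXX X p : lie_bracket X X p = 0.
Proof. by apply: val_inj; apply/funext => f; exact: subrr. Qed.

Lemma killing_eq X : is_killing g X -> forall Y Z p,
  X p (metric_app g Y Z) =
  g p (lie_bracket X Y p) (Z p) + g p (Y p) (lie_bracket X Z p).
Proof.
move=> kX Y Z p; apply/eqP; rewrite -subr_eq0 opprD addrA; apply/eqP.
by have := congr1 (fun f : smooth_fun M => smooth_val f p) (kX Y Z).
Qed.

Section UnitKilling.
Variable xi : vector_field M.
Hypotheses (xi_killing : is_killing g xi)
  (xi_unit : forall p : M, tangent_norm g (xi p) = 1).

Lemma unit_metric : metric_app g xi xi = 1.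
Proof.
apply: val_inj; apply/funext => p; rewrite -[LHS]/(g p (xi p) (xi p)).
have := xi_unit p; rewrite /tangent_norm => E.
(* [Num.sqrt] is 0 on negative numbers, so the value 1 excludes them; this avoids a case split on
   [xi p = 0]. *)
have ge0 : 0 <= g p (xi p) (xi p).
  rewrite leNgt; apply/negP => /ltW/ler0_sqrtr.
  by rewrite E => /eqP; rewrite oner_eq0.
by rewrite -[LHS](sqr_sqrtr ge0) E expr1n.
Qed.

(** The Killing equation of [X] on the pair (xi, xi): the two terms on the right agree by symmetry
    and add up to X(1) = 0. *)
Lemma killing_lie_unit_orthogonal X p : is_killing g X ->
  g p (xi p) (lie_bracket xi X p) = 0.
Proof.
move=> kX; have := killing_eq kX xi xi p.
rewrite unit_metric tangent1 Defs.metric_sym -mulr2n => /esym/eqP.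
by rewrite mulrn_eq0 lie_bracketC metricNr oppr_eq0 => /eqP.
Qed.

Lemma eigen_unit_orthogonal X a p : is_killing g X -> a != 0 ->
  lie_bracket xi (lie_bracket xi X) = a *: X -> g p (xi p) (X p) = 0.
Proof.
move=> kX a0 eX.
(* The orthogonality is needed as an identity of functions, since it is differentiated along [xi]
   next. *)
have bX0 : metric_app g xi (lie_bracket xi X) = 0.
  by apply: val_inj; apply/funext => q; exact: killing_lie_unit_orthogonal.
have := killing_eq xi_killing xi (lie_bracket xi X) p.
rewrite bX0 tangent0 lie_bracketXX Defs.metric_sym metric0r add0r eX.
by rewrite metricZr => /esym/eqP; rewrite mulf_eq0 (negPf a0) => /eqP.
Qed.

End UnitKilling.

(** As g(xi,X) = 0, dxi(X,Y) = X g(xi,Y) - g(xi,[X,Y]), which the Killing equation of [X] turns into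
    g([X,xi],Y). *)
Lemma lie_deriv_orthogonal X Y (xi : vector_field M) : is_killing g X ->
  (forall p, orthogonal_at g (X p) (xi p)) ->
  form_app (flat g (lie_deriv xi X)) Y =
  - interior_prod X (ext_deriv (flat g xi)) Y.
Proof.
move=> kX oX; have X0 : form_app (flat g xi) X = 0.
  apply: val_inj; apply/funext => p; rewrite -[RHS](oX p).
  exact: Defs.metric_sym.
apply: val_inj; apply/funext => p.
rewrite /interior_prod /ext_deriv X0.
rewrite -[LHS]/(g p (lie_bracket xi X p) (Y p)).
rewrite -[RHS]/(- (X p (metric_app g xi Y) - Y p 0
  - g p (xi p) (lie_bracket X Y p))).
rewrite tangent0 subr0 (killing_eq kX) addrK lie_bracketC.
by rewrite Defs.metric_sym metricNr Defs.metric_sym.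
Qed.

End KillingFields.

Section SumSubspaces.
Variables (R : realType) (E : lmodType R) (I : finType).
Implicit Types V : I -> set E.

Lemma sum_subspaces_sub V i x : (forall j, is_subspace (V j)) ->
  V i x -> sum_subspaces V x.
Proof.
move=> sV Vx; exists (fun j => if j == i then x else 0).
  by move=> j; case: eqP => [->//|_]; have [] := sV j.
by rewrite -big_mkcond big_pred1_eq.
Qed.

Lemma sum_subspaces_option (V0 : set E) V x : V0 0 ->
  sum_subspaces V x -> sum_subspaces (oapp V V0) x.
Proof.
move=> V00 [x_ Vx ->]; exists (oapp x_ 0); first by case.
(* The zero term at [None] is split off; on the rest, [id] on [option I] serves as the partial
   inverse of [Some]. *)
rewrite [RHS](bigD1 None)//= add0r (reindex_omap Some id) /=; last by case.
by apply: eq_bigl => i; rewrite eqxx.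
Qed.

End SumSubspaces.

Theorem lemma2p4 (R : realType) (n : nat) (M : smooth_manifold R n)
    (M_compact : compact [set: M]) (M_connected : connected [set: M])
    (g : riemannian_metric M) (xi : vector_field M)
    (xi_killing : is_killing g xi)
    (xi_unit : forall p : M, tangent_norm g (xi p) = 1)
    (s : nat) (lambda : 'I_s -> R)
    (V0 : set (vector_field M)) (V : 'I_s -> set (vector_field M))
    (decomp : standard_decomposition g xi lambda V0 V)
    (A : vector_field M) (AV : sum_subspaces V A) :
  (forall p : M, orthogonal_at g (A p) (xi p)) /\
  (forall Y : vector_field M,
     form_app (flat g (lie_deriv xi A)) Y =
     - interior_prod A (ext_deriv (flat g xi)) Y).
Proof.
have [[subV killingE _] _ lambda_gt0 _ eigenV] := decomp.
have kA : is_killing g A.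
  suff : killing_fields g A by [].
  by rewrite killingE; apply: sum_subspaces_option => //; have [] := subV None.
suff oA p : orthogonal_at g (A p) (xi p).
  by split=> // Y; exact: lie_deriv_orthogonal.
(* By linearity it suffices to treat each component of [A]; as an element of one summand, it is
   itself Killing. *)
have [x_ Vx ->] := AV.
rewrite /orthogonal_at Defs.metric_sym metric_sumr big1// => k _.
apply: (eigen_unit_orthogonal xi_killing xi_unit _ _ _ (eigenV k _ (Vx k))).
  suff : killing_fields g (x_ k) by [].
  by rewrite killingE; exact: (sum_subspaces_sub (i := Some k)).
(* The eigenvalue [- (lambda k ^+ 2)] is nonzero because [lambda k] is positive. *)
by rewrite oppr_eq0 expf_neq0// gt_eqF.
Qed.
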